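(* $\mathsf{SIPT}^2_2 \not\le_{\rm sc} \mathsf{D}^2_2$.
   Context: A 2-coloring of pairs is $f:[\omega]^2\to 2$, with $f(x,y)$ meaning $f(\{x,y\})$ for $x<y$; it is stable if $\lim_u f(x,u)$ exists for all $x$. $A\oplus B=\{2x:x\in A\}\cup\{2y+1:y\in B\}$. A set $H=H_L\oplus H_R$ with $H_L,H_R$ infinite is increasing p-homogeneous for $f$ if $f(x,y)$ is constant over $x\in H_L$, $y\in H_R$, $x<y$. An infinite set $H$ is limit homogeneous for $f$ if $\lim_u f(x,u)$ is the same for all $x\in H$. $\mathsf{SIPT}^2_2$ (resp. $\mathsf{D}^2_2$) is the problem whose instances are stable 2-colorings of pairs $f$ and whose solutions are the sets increasing p-homogeneous (resp. limit homogeneous) for $f$. $\mathsf P\le_{\rm sc}\mathsf Q$ (strongly computably reducible) if every instance $X$ of $\mathsf P$ computes an instance $\widehat X$ of $\mathsf Q$ such that every solution $\widehat Y$ of $\widehat X$ computes (by itself, without $X$) some solution of $X$. *)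

(* Defs.v *)
From Stdlib Require Import Arith List Cantor.
Import ListNotations.

Inductive prog : Type :=
| PZero : prog
| PSucc : prog
| PProj : nat -> prog
| POracle : prog
| PComp : prog -> list prog -> prog
| PPrim : prog -> prog -> prog
| PMu : prog -> prog.

Inductive eval (O : nat -> bool) : prog -> list nat -> nat -> Prop :=
| ev_zero args : eval O PZero args 0
| ev_succ x args : eval O PSucc (x :: args) (S x)
| ev_proj i args v : nth_error args i = Some v -> eval O (PProj i) args v
| ev_oracle x args : eval O POracle (x :: args) (if O x then 1 else 0)
| ev_comp f gs args ys v :
    Forall2 (fun g y => eval O g args y) gs ys ->
    eval O f ys v -> eval O (PComp f gs) args v
| ev_prim0 b s args v : eval O b args v -> eval O (PPrim b s) (0 :: args) v
| ev_primS b s n args r v :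
    eval O (PPrim b s) (n :: args) r ->
    eval O s (n :: r :: args) v ->
    eval O (PPrim b s) (S n :: args) v
| ev_mu f args v :
    eval O f (v :: args) 0 ->
    (forall k, k < v -> exists m, eval O f (k :: args) (S m)) ->
    eval O (PMu f) args v.

Definition b2n (b : bool) : nat := if b then 1 else 0.

Definition Turing_computes (O A : nat -> bool) : Prop :=
  exists e : prog, forall n, eval O e [n] (b2n (A n)).

(** A 2-colouring of pairs f : [omega]^2 -> 2, with f x y meaning f({x,y}) for x < y.
    Values f x y with x >= y are irrelevant (never used below). *)
Definition coloring := nat -> nat -> bool.

Definition coloring_code (f : coloring) : nat -> bool :=
  fun n => let '(x, y) := Cantor.of_nat n in if x <? y then f x y else false.

Definition Turing_computes_coloring (O : nat -> bool) (g : coloring) : Prop :=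
  exists e : prog, forall x y, x < y -> eval O e [x; y] (b2n (g x y)).

Definition limit_is (f : coloring) (x : nat) (c : bool) : Prop :=
  exists N, forall u, N <= u -> x < u -> f x u = c.

Definition stable (f : coloring) : Prop := forall x, exists c, limit_is f x c.

Definition infinite (H : nat -> bool) : Prop := forall n, exists m, n <= m /\ H m = true.

Definition left_part (H : nat -> bool) : nat -> bool := fun x => H (2 * x).
Definition right_part (H : nat -> bool) : nat -> bool := fun y => H (2 * y + 1).

Definition increasing_p_homogeneous (f : coloring) (H : nat -> bool) : Prop :=
  infinite (left_part H) /\ infinite (right_part H) /\
  exists c, forall x y, left_part H x = true -> right_part H y = true -> x < y ->
    f x y = c.

Definition limit_homogeneous (f : coloring) (H : nat -> bool) : Prop :=
  infinite H /\ exists c, forall x, H x = true -> limit_is f x c.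

Definition SIPT22_instance (f : coloring) : Prop := stable f.
Definition SIPT22_solution (f : coloring) (H : nat -> bool) : Prop :=
  increasing_p_homogeneous f H.
Definition D22_instance (f : coloring) : Prop := stable f.
Definition D22_solution (f : coloring) (H : nat -> bool) : Prop :=
  limit_homogeneous f H.

Definition SIPT22_sc_reducible_to_D22 : Prop :=
  forall f : coloring, SIPT22_instance f ->
    exists g : coloring,
      D22_instance g /\ Turing_computes_coloring (coloring_code f) g /\
      forall Y, D22_solution g Y ->
        exists Z, SIPT22_solution f Z /\ Turing_computes Y Z.

(* Main.v *)
Require Import Defs.
From Stdlib Require Import Arith List Bool Lia Cantor Classical ClassicalEpsilon.
Import ListNotations.

(** For an increasing sequence n, let f(x,y) = 1 exactly when x and y lie in a
    common interval [n_k, n_(k+1)).  All limits of f are 0, so no p-homogeneous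
    set H for f has x in H_L and y > x in H_R in a common interval.  If n is
    sufficiently generic, then for every set A whatsoever there is an infinite
    subset of A or of its complement that computes no such H.  This is a Mathias
    forcing argument with conditions (s_0, s_1, X), whose reservoirs X come from
    a countable family fixed before n is chosen.  To treat functionals e_0, e_1
    ask whether there are m = n_k and M such that, for every partition of X into
    two pieces, some extension of some s_i inside the i-th piece makes e_i
    enumerate a pair x < y from [m, M).  If so, genericity makes M = n_(k+1),
    and the partition given by A yields an extension defeating e_i.  If not,
    compactness gives one partition of X along which, on either side i, e_i
    enumerates no pair above m; shrink X to an infinite piece of it.  The one
    obstruction, a reservoir meeting A or its complement in a finite set, is
    harmless: n is also generic for the tails of the reservoirs themselves. *)

(** [PComp] nests [prog] inside [list]; the [Forall] premise supplies the induction hypothesis for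
    the members of [gs]. *)
Lemma prog_nested_ind (P : prog -> Prop) :
  P PZero -> P PSucc -> (forall i, P (PProj i)) -> P POracle ->
  (forall f gs, P f -> Forall P gs -> P (PComp f gs)) ->
  (forall b s, P b -> P s -> P (PPrim b s)) ->
  (forall f, P f -> P (PMu f)) ->
  forall e, P e.
Proof.
  intros Hz Hs Hp Ho Hc Hr Hm.
  fix IH 1. intros [| |i| |f gs|b s|f].
  (* With [IH] in context, [auto] could close these goals by an unguarded recursive call. *)
  1-4: clear IH; auto.
  2: now apply Hr.
  2: now apply Hm.
  apply Hc; [apply IH|].
  induction gs as [|g gs IHgs]; constructor; auto.
Qed.

(** * Countability *)

Definition countable (T : Type) : Prop :=
  exists c : T -> nat, forall x y, c x = c y -> x = y.

Lemma countable_nat : countable nat.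
Proof. now exists (fun n => n). Qed.

Lemma countable_bool : countable bool.
Proof. exists b2n. now intros [] []. Qed.

Lemma countable_prod (T U : Type) : countable T -> countable U -> countable (T * U).
Proof.
  intros [c Hc] [d Hd].
  exists (fun p => Cantor.to_nat (c (fst p), d (snd p))).
  intros [x y] [x' y'] H%Cantor.to_nat_inj. cbn in H. injection H as H1 H2.
  f_equal; auto.
Qed.

Lemma countable_sum (T U : Type) : countable T -> countable U -> countable (T + U).
Proof.
  intros [c Hc] [d Hd].
  exists (fun s => match s with inl x => 2 * c x | inr y => 2 * d y + 1 end).
  intros [x|x] [y|y] H; try lia; f_equal; [apply Hc|apply Hd]; lia.
Qed.

Fixpoint list_code (l : list nat) : nat :=
  match l with [] => 0 | x :: l => S (Cantor.to_nat (x, list_code l)) end.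

Lemma list_code_inj l l' : list_code l = list_code l' -> l = l'.
Proof.
  revert l'; induction l as [|x l IH]; intros [|y l'] H; try easy.
  apply eq_add_S, Cantor.to_nat_inj in H. injection H as -> H. f_equal; auto.
Qed.

(** Injectivity is asked only at the members of [l], because the induction for [prog_code] provides
    it only for subprograms. *)
Lemma map_inj_Forall (T U : Type) (c : T -> U) (l l' : list T) :
  Forall (fun x => forall y, c x = c y -> x = y) l -> map c l = map c l' -> l = l'.
Proof.
  intros H; revert l'; induction H as [|x l Hx _ IH]; intros [|y l'] E; try easy.
  injection E as E1 E2. f_equal; auto.
Qed.

Lemma countable_list (T : Type) : countable T -> countable (list T).
Proof.
  intros [c Hc]. exists (fun l => list_code (map c l)).
  intros l l' H%list_code_inj. revert H. apply map_inj_Forall, Forall_forall. auto.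
Qed.

Fixpoint prog_code (e : prog) : nat :=
  match e with
  | PZero => list_code [0]
  | PSucc => list_code [1]
  | PProj i => list_code [2; i]
  | POracle => list_code [3]
  | PComp f gs => list_code (4 :: prog_code f :: map prog_code gs)
  | PPrim b s => list_code [5; prog_code b; prog_code s]
  | PMu f => list_code [6; prog_code f]
  end.

Lemma countable_prog : countable prog.
Proof.
  exists prog_code. intros e.
  induction e as [| |i| |f gs IHf IHgs|b s IHb IHs|f IHf] using prog_nested_ind;
    intros [| |j| |f' gs'|b' s'|f'] H; cbn [prog_code] in H;
    apply list_code_inj in H; try discriminate H; try reflexivity.
  - now injection H as ->.
  - injection H as H1 H2. f_equal; [auto|]. revert H2. now apply map_inj_Forall.
  - injection H as H1 H2. f_equal; auto.
  - injection H as H1. f_equal; auto.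
Qed.

(** * Evaluation: determinism and use principle *)

Lemma eval_deterministic O e args v w :
  eval O e args v -> eval O e args w -> v = w.
Proof.
  revert args v w.
  induction e as [| |i| |f gs IHf IHgs|b s IHb IHs|f IHf] using prog_nested_ind;
    intros args v w Hv Hw.
  - inversion Hv; subst; inversion Hw; congruence.
  - inversion Hv; subst; inversion Hw; congruence.
  - inversion Hv; subst; inversion Hw; congruence.
  - inversion Hv; subst; inversion Hw; congruence.
  - inversion Hv as [| | | |? ? ? ys ? Hys Hfv| | |]; subst.
    inversion Hw as [| | | |? ? ? zs ? Hzs Hfw| | |]; subst.
    assert (ys = zs) as ->; [|eauto].
    clear - IHgs Hys Hzs. revert zs Hzs.
    induction Hys; intros zs Hzs; inversion Hzs; subst; [easy|].
    inversion IHgs; subst. f_equal; eauto.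
  - destruct args as [|n args]; [inversion Hv|].
    revert v w Hv Hw. induction n as [|n IH]; intros v w Hv Hw.
    + inversion Hv; inversion Hw; subst; eauto.
    + inversion Hv as [| | | | | |? ? ? ? r ? Hr Hsv|]; subst.
      inversion Hw as [| | | | | |? ? ? ? r' ? Hr' Hsw|]; subst.
      rewrite (IH _ _ Hr' Hr) in Hsw. eauto.
  - inversion Hv as [| | | | | | |? ? ? Hv0 Hvlt]; subst.
    inversion Hw as [| | | | | | |? ? ? Hw0 Hwlt]; subst.
    (* If the results differ, [f] yields 0 at the smaller one by one derivation and a successor by
       the other. *)
    destruct (Nat.lt_trichotomy v w) as [Hlt|[Heq|Hlt]]; [|easy|].
    + destruct (Hwlt v Hlt) as [r Hr]. discriminate (IHf _ _ _ Hv0 Hr).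
    + destruct (Hvlt w Hlt) as [r Hr]. discriminate (IHf _ _ _ Hw0 Hr).
Qed.

Definition agree (N : nat) (O O' : nat -> bool) : Prop := forall x, x < N -> O' x = O x.

(** [Q] holds on a neighbourhood of [O] in Cantor space. The existential bound spares computing the
    use of a computation. *)
Definition locally (O : nat -> bool) (Q : (nat -> bool) -> Prop) : Prop :=
  exists N, forall O', agree N O O' -> Q O'.

Lemma locally_and O (Q R : (nat -> bool) -> Prop) :
  locally O Q -> locally O R -> locally O (fun O' => Q O' /\ R O').
Proof.
  intros [N HN] [K HK]. exists (N + K).
  intros O' H; split; [apply HN|apply HK]; intros x Hx; apply H; lia.
Qed.

Lemma locally_impl O (Q R : (nat -> bool) -> Prop) :
  (forall O', Q O' -> R O') -> locally O Q -> locally O R.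
Proof. intros H [N HN]. exists N; auto. Qed.

Lemma locally_forall_lt O (Q : nat -> (nat -> bool) -> Prop) n :
  (forall k, k < n -> locally O (Q k)) -> locally O (fun O' => forall k, k < n -> Q k O').
Proof.
  induction n as [|n IH]; intros H.
  - exists 0. intros; lia.
  - refine (locally_impl _ _ _ _ (locally_and _ _ _ (IH _) (H n _))); auto.
    intros O' [H1 H2] k Hk. destruct (Nat.eq_dec k n) as [->|]; [easy|apply H1; lia].
Qed.

Lemma eval_use O e args v : eval O e args v -> locally O (fun O' => eval O' e args v).
Proof.
  revert args v.
  induction e as [| |i| |f gs IHf IHgs|b s IHb IHs|f IHf] using prog_nested_ind;
    intros args v Hv.
  - inversion Hv; subst. exists 0. constructor.
  - inversion Hv; subst. exists 0. constructor.
  - inversion Hv; subst. exists 0. now constructor.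
  - inversion Hv as [| | |x| | | |]; subst. exists (S x).
    intros O' H. rewrite <- (H x) by lia. constructor.
  - inversion Hv as [| | | |? ? ? ys ? Hys Hfv| | |]; subst.
    assert (Hgs : locally O (fun O' => Forall2 (fun g y => eval O' g args y) gs ys)).
    { clear - IHgs Hys. induction Hys.
      - exists 0. constructor.
      - inversion IHgs; subst.
        refine (locally_impl _ _ _ _ (locally_and _ _ _ (H2 _ _ H) (IHHys H3))).
        intros O' [? ?]; now constructor. }
    refine (locally_impl _ _ _ _ (locally_and _ _ _ Hgs (IHf _ _ Hfv))).
    intros O' [? ?]; econstructor; eauto.
  - destruct args as [|n args]; [inversion Hv|].
    revert v Hv. induction n as [|n IH]; intros v Hv.
    + inversion Hv; subst. eapply locally_impl; [|eauto]. intros; now constructor.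
    + inversion Hv as [| | | | | |? ? ? ? r ? Hr Hsv|]; subst.
      refine (locally_impl _ _ _ _ (locally_and _ _ _ (IH _ Hr) (IHs _ _ Hsv))).
      intros O' [? ?]; econstructor; eauto.
  - inversion Hv as [| | | | | | |? ? ? Hv0 Hlt]; subst.
    refine (locally_impl _ _ _ _ (locally_and _ _ _ (IHf _ _ Hv0)
      (locally_forall_lt _ (fun k O' => exists m, eval O' f (k :: args) (S m)) v _))).
    + intros O' [? ?]; now constructor.
    + intros k Hk. destruct (Hlt k Hk) as [m Hm].
      refine (locally_impl _ _ _ _ (IHf _ _ Hm)). eauto.
Qed.

(** * Choice and compactness *)

Lemma dependent_choice (T : Type) (I : nat -> T -> Prop) (R : nat -> T -> T -> Prop) x0 :
  I 0 x0 ->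
  (forall n x, I n x -> exists y, I (S n) y /\ R n x y) ->
  exists s : nat -> T, s 0 = x0 /\ forall n, I n (s n) /\ R n (s n) (s (S n)).
Proof.
  intros H0 Hstep.
  assert (F : forall n x, {y | I n x -> I (S n) y /\ R n x y}).
  { intros n x. apply constructive_indefinite_description.
    (* Where the invariant fails, [x] is a dummy value that keeps [F] total. *)
    destruct (classic (I n x)) as [H|H]; [|now exists x].
    destruct (Hstep n x H) as [y Hy]. now exists y. }
  set (s := fix s n := match n with 0 => x0 | S n => proj1_sig (F n (s n)) end).
  assert (HI : forall n, I n (s n)).
  { induction n as [|n IH]; [easy|]. exact (proj1 (proj2_sig (F n (s n)) IH)). }
  exists s. split; [easy|]. intros n; split; [apply HI|].
  exact (proj2 (proj2_sig (F n (s n)) (HI n))).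
Qed.

(** Sequential compactness of Cantor space: bits are fixed one by one, keeping a prefix shared by
    infinitely many terms. *)
Lemma cluster_point (S : nat -> nat -> bool) :
  exists T, forall n K, exists N, K <= N /\ agree n T (S N).
Proof.
  set (I := fun n h => forall K, exists N, K <= N /\ agree n h (S N)).
  destruct (dependent_choice (nat -> bool) I (fun n h h' => agree n h h') (fun _ => true))
    as [s [_ Hs]].
  - intros K. exists K. split; [easy|]. intros x Hx; lia.
  - intros n h Hh.
    assert (Hb : exists b, forall K, exists N, K <= N /\ agree n h (S N) /\ S N n = b).
    { apply NNPP; intros Hno.
      destruct (not_all_ex_not _ _ (not_ex_all_not _ _ Hno true)) as [K1 H1].
      destruct (not_all_ex_not _ _ (not_ex_all_not _ _ Hno false)) as [K2 H2].
      destruct (Hh (K1 + K2)) as [N [HN Ha]].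
      destruct (S N n) eqn:E; [apply H1|apply H2]; exists N; repeat split; auto; lia. }
    destruct Hb as [b Hb].
    exists (fun x => if x =? n then b else h x). split.
    + intros K. destruct (Hb K) as [N [HN [Ha E]]]. exists N. split; [easy|].
      intros x Hx. destruct (Nat.eqb_spec x n) as [->|]; [easy|]. apply Ha; lia.
    + intros x Hx. destruct (Nat.eqb_spec x n); [lia|easy].
  - exists (fun x => s (Datatypes.S x) x).
    assert (Hst : forall x d, s (d + Datatypes.S x) x = s (Datatypes.S x) x).
    { intros x d; induction d as [|d IH]; [easy|]. rewrite <- IH.
      apply (proj2 (Hs (d + Datatypes.S x))); lia. }
    intros n K. destruct (proj1 (Hs n) K) as [N [HN Ha]]. exists N. split; [easy|].
    intros x Hx. rewrite Ha by easy. rewrite <- (Hst x (n - Datatypes.S x)). f_equal; lia.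
Qed.

(** Requirement [t] is treated once, at stage [c t]: either the next value is put beyond a witness
    [M], or the current value already witnesses the second alternative. *)
Lemma generic_sequence (T : Type) (P : T -> nat -> nat -> Prop) :
  countable T ->
  (forall t m M M', M <= M' -> P t m M -> P t m M') ->
  exists n : nat -> nat, (forall k, n k < n (S k)) /\
    forall t, (exists k, P t (n k) (n (S k))) \/ (exists m, forall M, ~ P t m M).
Proof.
  intros [c Hc] Hmono.
  destruct (dependent_choice nat (fun _ _ => True)
    (fun k m m' => m < m' /\ forall t, c t = k -> P t m m' \/ forall M, ~ P t m M) 0)
    as [n [_ Hn]]; [easy| |].
  - intros k m _.
    destruct (classic (exists t M, c t = k /\ P t m M)) as [[t [M [Ht HP]]]|Hno].
    + exists (S m + M). repeat split; [lia|]. intros t' Ht'.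
      rewrite (Hc t' t) by congruence. left. apply (Hmono t m M); [lia|easy].
    + exists (S m). repeat split; [lia|]. intros t Ht. right. intros M HM.
      apply Hno; eauto.
  - exists n. split; [apply Hn|]. intros t.
    destruct (proj2 (proj2 (Hn (c t))) t eq_refl); eauto.
Qed.

(** * The forcing *)

Definition inter (X Y : nat -> bool) : nat -> bool := fun x => X x && Y x.
Definition side (S : nat -> bool) (i : bool) : nat -> bool := fun x => eqb (S x) i.
Definition pick {T : Type} (p : T * T) (i : bool) : T := if i then fst p else snd p.

(** [2 * a] and [2 * b + 1] code [a] on the left and [b] on the right of a join. Only two
    computations are involved, so the condition is open in [Y]. *)
Definition hit (e : prog) (Y : nat -> bool) (m M : nat) : Prop :=
  exists a b, m <= a /\ a < b /\ b < M /\ eval Y e [2 * a] 1 /\ eval Y e [2 * b + 1] 1.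

Definition avoids (n : nat -> nat) (e : prog) (Y : nat -> bool) : Prop :=
  (exists k, hit e Y (n k) (n (S k))) \/ (exists m, forall M, ~ hit e Y m M).

(** Membership of [Y] in the Mathias neighbourhood with stem [s], given as a bit string, and
    reservoir [X]. *)
Definition extends (s : list bool) (X Y : nat -> bool) : Prop :=
  (forall x, x < length s -> Y x = nth x s false) /\
  (forall x, length s <= x -> Y x = true -> X x = true).

Definition trunc (Z : nat -> bool) (N : nat) : list bool := map Z (seq 0 N).

Lemma hit_mono e Y m M M' : M <= M' -> hit e Y m M -> hit e Y m M'.
Proof. intros HM [a [b H]]. exists a, b. repeat split; try easy; lia. Qed.

Lemma hit_locally e Y m M : hit e Y m M -> locally Y (fun Y' => hit e Y' m M).
Proof.
  intros [a [b [H1 [H2 [H3 [Ha Hb]]]]]].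
  refine (locally_impl _ _ _ _ (locally_and _ _ _ (eval_use _ _ _ _ Ha) (eval_use _ _ _ _ Hb))).
  intros Y' [? ?]. now exists a, b.
Qed.

Lemma inter_true X Y x : inter X Y x = true <-> X x = true /\ Y x = true.
Proof. apply andb_true_iff. Qed.

Lemma side_true S i x : side S i x = true <-> S x = i.
Proof. apply eqb_true_iff. Qed.

Lemma extends_sub s X X' Y :
  (forall x, X x = true -> X' x = true) -> extends s X Y -> extends s X' Y.
Proof. intros H [H1 H2]. split; auto. Qed.

Lemma extends_nth s X : extends s X (fun x => nth x s false).
Proof.
  split; [easy|]. intros x Hx H. rewrite nth_overflow in H by easy. discriminate.
Qed.

Lemma length_trunc Z N : length (trunc Z N) = N.
Proof. unfold trunc. now rewrite length_map, length_seq. Qed.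

Lemma nth_trunc Z N x : x < N -> nth x (trunc Z N) false = Z x.
Proof.
  intros H. unfold trunc.
  rewrite nth_indep with (d' := Z 0) by now rewrite length_map, length_seq.
  now rewrite map_nth, seq_nth.
Qed.

Lemma extends_trunc_agree Z N X Y : extends (trunc Z N) X Y -> agree N Z Y.
Proof.
  intros [H _] x Hx. rewrite H by now rewrite length_trunc. now apply nth_trunc.
Qed.

Lemma extends_trunc s X Z N Y :
  length s <= N -> extends s X Z -> extends (trunc Z N) X Y -> extends s X Y.
Proof.
  intros HN [Z1 Z2] HY. pose proof (extends_trunc_agree _ _ _ _ HY) as Ha. split.
  - intros x Hx. rewrite Ha by lia. auto.
  - intros x Hx Hxy. destruct (Nat.lt_ge_cases x N) as [H|H].
    + rewrite Ha in Hxy by easy. auto.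
    + apply (proj2 HY); [now rewrite length_trunc|easy].
Qed.

(** The forcing question. Quantifying over all partitions keeps it independent of [A], which is not
    yet known when [n] is chosen. *)
Definition splits (e : prog * prog) (s : list bool * list bool) (X : nat -> bool)
    (m M : nat) : Prop :=
  forall S, exists i Z, extends (pick s i) (inter X (side S i)) Z /\ hit (pick e i) Z m M.

Definition nonhitting (e : prog * prog) (s : list bool * list bool) (X : nat -> bool)
    (m : nat) (S : nat -> bool) : Prop :=
  forall i Z, extends (pick s i) (inter X (side S i)) Z -> forall M, ~ hit (pick e i) Z m M.

Lemma splits_compact e s X m :
  (forall M, ~ splits e s X m M) -> exists S, nonhitting e s X m S.
Proof.
  intros H.
  assert (HS : forall M, exists S, forall i Z,
             extends (pick s i) (inter X (side S i)) Z -> ~ hit (pick e i) Z m M).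
  { intros M. destruct (not_all_ex_not _ _ (H M)) as [S HS]. exists S.
    intros i Z HZ Hh. apply HS. eauto. }
  set (S := fun M => proj1_sig (constructive_indefinite_description _ (HS M))).
  pose proof (fun M => proj2_sig (constructive_indefinite_description _ (HS M))) as HSM.
  change (forall M i Z, extends (pick s i) (inter X (side (S M) i)) Z ->
    ~ hit (pick e i) Z m M) in HSM.
  destruct (cluster_point S) as [T HT]. exists T. intros i Z [Z1 Z2] M Hh.
  destruct (hit_locally _ _ _ _ Hh) as [u Hu].
  set (N := u + length (pick s i)).
  destruct (HT N M) as [K [HK Ha]].
  (* Cutting [Z] at [N] preserves the hit and leaves only elements on which [T] and [S K] agree, so
     [Z'] also respects the partition [S K]. *)
  set (Z' := fun x => Z x && (x <? N)).
  assert (HZ' : agree N Z Z').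
  { intros x Hx. unfold Z'. apply Nat.ltb_lt in Hx. now rewrite Hx, andb_true_r. }
  apply (HSM K i Z').
  - split.
    + intros x Hx. rewrite HZ' by (unfold N; lia). auto.
    + intros x Hx HZx. unfold Z' in HZx. apply andb_true_iff in HZx as [HZx Hlt].
      apply Nat.ltb_lt in Hlt. specialize (Z2 x Hx HZx).
      rewrite inter_true, side_true in *. now rewrite Ha.
  - apply hit_mono with M; [easy|]. apply Hu. intros x Hx. apply HZ'. unfold N; lia.
Qed.

(** * Coded reservoirs and the generic sequence *)

Definition split_step : Type := nat * (prog * prog) * (list bool * list bool) * bool.

(** The set chosen by [epsilon] is meaningful only if [splits e s X m M] fails for all [M]. *)
Fixpoint reservoir (c : list split_step) : nat -> bool :=
  match c with
  | [] => fun _ => true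
  | (m, e, s, i) :: c =>
      inter (reservoir c)
        (side (epsilon (inhabits (fun _ => true)) (nonhitting e s (reservoir c) m)) i)
  end.

Definition tail (X : nat -> bool) (k : nat) : nat -> bool := fun x => X x && (k <=? x).

(** The second clause settles the forcing question for every coded reservoir; the third serves the
    case of a reservoir almost contained in one side of [A]. *)
Definition generic (n : nat -> nat) : Prop :=
  (forall k, n k < n (S k)) /\
  (forall c e s, (exists k, splits e s (reservoir c) (n k) (n (S k))) \/
     (exists m, forall M, ~ splits e s (reservoir c) m M)) /\
  (forall c k e, avoids n e (tail (reservoir c) k)).

Lemma generic_exists : exists n, generic n.
Proof.
  set (P := fun (t : list split_step * (prog * prog) * (list bool * list bool)
                     + list split_step * nat * prog) (m M : nat) =>
    match t with
    | inl (c, e, s) => splits e s (reservoir c) m M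
    | inr (c, k, e) => hit e (tail (reservoir c) k) m M
    end).
  destruct (generic_sequence _ P) as [n [Hn HP]].
  - unfold split_step.
    repeat first [apply countable_sum | apply countable_prod | apply countable_list
                 | apply countable_nat | apply countable_bool | apply countable_prog].
  - intros [[[c e] s]|[[c k] e]] m M M' HM; cbn.
    + intros H S. destruct (H S) as [i [Z [HZ Hh]]]. exists i, Z.
      split; [easy|]. now apply hit_mono with M.
    + now apply hit_mono.
  - exists n. split; [easy|]. split.
    + intros c e s. exact (HP (inl (c, e, s))).
    + intros c k e. exact (HP (inr (c, k, e))).
Qed.

Lemma infinite_side X S : infinite X -> exists i, infinite (inter X (side S i)).
Proof.
  intros HX. apply NNPP; intros Hno.
  destruct (not_all_ex_not _ _ (not_ex_all_not _ _ Hno true)) as [K1 H1].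
  destruct (not_all_ex_not _ _ (not_ex_all_not _ _ Hno false)) as [K2 H2].
  destruct (HX (K1 + K2)) as [x [Hx HXx]].
  destruct (S x) eqn:E; [apply H1|apply H2]; exists x; (split; [lia|]);
    now rewrite inter_true, side_true.
Qed.

(** * Conditions and their extensions for a fixed set *)

Definition condition : Type := (list bool * list bool) * list split_step.

(** The side of [A] is intersected here and not in the reservoir, which must stay in the countable
    family. *)
Definition meets (A : nat -> bool) (p : condition) (i : bool) (Y : nat -> bool) : Prop :=
  extends (pick (fst p) i) (inter (reservoir (snd p)) (side A i)) Y.

Section Extension.

Variables (n : nat -> nat) (A : nat -> bool).
Hypothesis n_generic : generic n.
Hypothesis reservoir_meets_sides :
  forall c, infinite (reservoir c) -> forall i, infinite (inter (reservoir c) (side A i)).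

Lemma extend_decide (p : condition) (e : prog * prog) :
  infinite (reservoir (snd p)) ->
  exists q : condition, infinite (reservoir (snd q)) /\
    (forall i Y, meets A q i Y -> meets A p i Y) /\
    exists i, forall Y, meets A q i Y -> avoids n (pick e i) Y.
Proof.
  destruct p as [s c]; intros Hinf; cbn in Hinf.
  destruct (proj1 (proj2 n_generic) c e s) as [[k Hk]|[m Hm]].
  (* The question is instantiated at the partition given by [A]; a long enough piece of [Z] becomes
     the new stem on side [i]. *)
  - destruct (Hk A) as [i [Z [HZ Hh]]].
    destruct (hit_locally _ _ _ _ Hh) as [u Hu].
    set (t := trunc Z (u + length (pick s i))).
    exists (if i then (t, snd s) else (fst s, t), c). split; [easy|]. split.
    + intros j Y. unfold meets. cbn [fst snd].
      assert (Ht : extends t (inter (reservoir c) (side A i)) Y ->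
                   extends (pick s i) (inter (reservoir c) (side A i)) Y).
      { apply extends_trunc; [lia|easy]. }
      destruct i, j; cbn [pick fst snd] in *; auto.
    + exists i. intros Y HY. left. exists k. apply Hu.
      assert (HY' : agree (u + length (pick s i)) Z Y).
      { eapply (extends_trunc_agree Z). unfold meets in HY. destruct i; exact HY. }
      intros x Hx. apply HY'; lia.
  - destruct (splits_compact _ _ _ _ Hm) as [S0 HS0].
    pose proof (epsilon_spec (inhabits (fun _ => true))
      (nonhitting e s (reservoir c) m) (ex_intro _ S0 HS0)) as HS.
    destruct (infinite_side _ (epsilon (inhabits (fun _ => true))
      (nonhitting e s (reservoir c) m)) Hinf) as [i Hi].
    (* The index of the kept piece is also the side that wins: below the new reservoir, side [i]
       draws only from piece [i] of the nonhitting partition. *)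
    exists (s, (m, e, s, i) :: c). split; [easy|]. split.
    + intros j Y. unfold meets; cbn [fst snd]. apply extends_sub. intros x.
      cbn [reservoir]. rewrite !inter_true. tauto.
    + exists i. intros Y HY. right. exists m. apply (HS i).
      revert HY. unfold meets; cbn [fst snd]. apply extends_sub. intros x.
      cbn [reservoir]. rewrite !inter_true. tauto.
Qed.

Lemma extend_grow (p : condition) (k : nat) :
  infinite (reservoir (snd p)) ->
  exists q : condition, infinite (reservoir (snd q)) /\
    (forall i Y, meets A q i Y -> meets A p i Y) /\
    forall i, exists x, k <= x /\ x < length (pick (fst q) i) /\
                        nth x (pick (fst q) i) false = true.
Proof.
  destruct p as [s c]; intros Hinf; cbn in Hinf.
  assert (H : forall i, exists t,
    (forall Y, extends t (inter (reservoir c) (side A i)) Y ->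
               extends (pick s i) (inter (reservoir c) (side A i)) Y) /\
    exists x, k <= x /\ x < length t /\ nth x t false = true).
  { intros i.
    destruct (reservoir_meets_sides c Hinf i (k + length (pick s i))) as [x [Hx HXx]].
    set (Z := fun y => nth y (pick s i) false || (y =? x)).
    exists (trunc Z (S x)). split.
    - intros Y. apply extends_trunc; [lia|]. split.
      + intros y Hy. unfold Z. destruct (Nat.eqb_spec y x); [lia|]. apply orb_false_r.
      + intros y Hy. unfold Z. rewrite nth_overflow by easy. cbn.
        intros ->%Nat.eqb_eq. easy.
    - exists x. rewrite length_trunc, nth_trunc by lia. repeat split; try lia.
      unfold Z. now rewrite Nat.eqb_refl, orb_true_r. }
  destruct (H true) as [t [Ht1 Ht2]], (H false) as [u [Hu1 Hu2]].
  exists ((t, u), c). split; [easy|]. split; [intros []|intros []]; auto.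
Qed.

Lemma two_sided_avoidance (es : nat -> prog * prog) :
  exists Y : bool -> nat -> bool,
    (forall i, infinite (Y i) /\ forall x, Y i x = true -> A x = i) /\
    (forall k, exists i, avoids n (pick (es k) i) (Y i)).
Proof.
  destruct (dependent_choice condition (fun _ p => infinite (reservoir (snd p)))
    (fun k p q => (forall i Y, meets A q i Y -> meets A p i Y) /\
       (exists i, forall Y, meets A q i Y -> avoids n (pick (es k) i) Y) /\
       forall i, exists x, k <= x /\ x < length (pick (fst q) i) /\
                           nth x (pick (fst q) i) false = true)
    (([], []), [])) as [p [Hp0 Hp]].
  - intros x. now exists x.
  - intros k p Hinf.
    destruct (extend_decide p (es k) Hinf) as [q [Hq [Hpq [i Hi]]]].
    destruct (extend_grow q k Hq) as [r [Hr [Hqr Hg]]].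
    exists r. split; [easy|]. split; [auto|]. split; [|easy]. exists i; auto.
  - assert (Hnest : forall d k i Y, meets A (p (d + k)) i Y -> meets A (p k) i Y).
    { induction d as [|d IH]; intros k i Y H; [easy|].
      apply IH, (proj1 (proj2 (Hp (d + k)))), H. }
    assert (Hlen : forall k i, k <= length (pick (fst (p k)) i)).
    { intros [|k] i; [lia|].
      destruct (proj2 (proj2 (proj2 (Hp k))) i) as [x [H1 [H2 _]]]. lia. }
    set (Z := fun k i x => nth x (pick (fst (p k)) i) false).
    assert (HZ : forall d k i, meets A (p k) i (Z (d + k) i)).
    { intros d k i. apply (Hnest d). apply extends_nth. }
    (* The stem at stage [S x] has length at least [S x], so bit [x] is final there. *)
    set (Y := fun i x => Z (S x) i x).
    assert (HYZ : forall d i x, Y i x = Z (d + S x) i x).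
    { intros d i x. symmetry. apply (proj1 (HZ d (S x) i)). apply Hlen. }
    assert (HY : forall k i, meets A (p k) i (Y i)).
    { intros k i. split; intros x Hx.
      - rewrite (HYZ k). replace (k + S x) with (S x + k) by lia.
        now apply (proj1 (HZ (S x) k i)).
      - rewrite (HYZ k). replace (k + S x) with (S x + k) by lia.
        now apply (proj2 (HZ (S x) k i)). }
    exists Y. split; [intros i; split|].
    + intros k. destruct (proj2 (proj2 (proj2 (Hp k))) i) as [x [H1 [H2 H3]]].
      exists x. split; [easy|]. rewrite <- H3. now apply (proj1 (HY (S k) i)).
    + intros x Hx. pose proof (proj2 (HY 0 i) x) as H. rewrite Hp0 in H.
      assert (Hl : length (pick ([], []) i : list bool) <= x) by (destruct i; cbn; lia).
      specialize (H Hl Hx). now rewrite inter_true, side_true in H.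
    + intros k. destruct (proj1 (proj2 (proj2 (Hp k)))) as [i Hi]. eauto.
Qed.

End Extension.

(** * From two sides to one *)

Lemma one_sided_avoidance (n : nat -> nat) (A : nat -> bool) :
  generic n ->
  exists Y i, infinite Y /\ (forall x, Y x = true -> A x = i) /\ forall e, avoids n e Y.
Proof.
  intros Hn.
  destruct (classic (forall c, infinite (reservoir c) ->
              forall i, infinite (inter (reservoir c) (side A i)))) as [HA|Hno].
  - destruct (countable_prod _ _ countable_prog countable_prog) as [c Hc].
    (* The epsilon term inverts the injective code [c], so every pair of programs is listed. *)
    destruct (two_sided_avoidance n A Hn HA
      (fun k : nat => epsilon (inhabits (PZero, PZero)) (fun e : prog * prog => c e = k))) as [Y [HY Hav]].
    assert (Hpair : forall e, exists i, avoids n (pick e i) (Y i)).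
    { intros e. destruct (Hav (c e)) as [i Hi]. exists i.
      rewrite (Hc _ e (epsilon_spec (inhabits (PZero, PZero))
        (fun e' => c e' = c e) (ex_intro _ e eq_refl))) in Hi. easy. }
    (* If some [e'] is not avoided on the true side, the pairs [(e', e)] force the false side to
       avoid every [e]. *)
    destruct (classic (forall e, avoids n e (Y true))) as [H|H].
    + exists (Y true), true. split; [apply HY|]. split; [apply HY|easy].
    + exists (Y false), false. split; [apply HY|]. split; [apply HY|]. intros e.
      apply not_all_ex_not in H as [e' He']. now destruct (Hpair (e', e)) as [[|] H].
  - apply not_all_ex_not in Hno as [c Hno]. apply imply_to_and in Hno as [Hinf Hno].
    apply not_all_ex_not in Hno as [i Hno]. apply not_all_ex_not in Hno as [k Hk].
    (* This reservoir has no element of side [i] from [k] on, so its tail lies in the opposite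
       side. *)
    exists (tail (reservoir c) k), (negb i). split; [|split].
    + intros m. destruct (Hinf (m + k)) as [x [Hx HXx]]. exists x. split; [lia|].
      unfold tail. rewrite HXx. apply Nat.leb_le; lia.
    + intros x Hx. apply andb_true_iff in Hx as [HXx Hx]. apply Nat.leb_le in Hx.
      destruct (bool_dec (A x) i) as [E|E]; [|now destruct (A x), i].
      exfalso. apply Hk. exists x. split; [easy|].
      now rewrite inter_true, side_true.
    + intros e. apply (proj2 (proj2 Hn)).
Qed.

(** * The interval coloring and the contradiction *)

Lemma characteristic_function (T : Type) (Q : T -> Prop) :
  exists h : T -> bool, forall x, h x = true <-> Q x.
Proof.
  exists (fun x => if excluded_middle_informative (Q x) then true else false).
  intros x. destruct (excluded_middle_informative (Q x)); easy.
Qed.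

Lemma interval_coloring (n : nat -> nat) :
  (forall k, n k < n (S k)) ->
  exists f : coloring,
    (forall x, limit_is f x false) /\
    forall k x y, n k <= x -> y < n (S k) -> f x y = true.
Proof.
  intros Hn.
  destruct (characteristic_function (nat * nat)
    (fun p => exists k, n k <= fst p /\ snd p < n (S k))) as [h Hh].
  assert (Hge : forall k, k <= n k).
  { induction k as [|k IH]; [lia|]. specialize (Hn k). lia. }
  assert (Hmono : forall j k, j <= k -> n j <= n k).
  { induction 1 as [|k _ IH]; [easy|]. specialize (Hn k). lia. }
  exists (fun x y => h (x, y)). split.
  (* Since [k <= n k], every interval starting at or below [x] has index at most [x] and ends by
     [n (S x)]. *)
  - intros x. exists (n (S x)). intros u Hu _.
    apply not_true_iff_false. intros [k [H1 H2]]%Hh. cbn in H1, H2.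
    pose proof (Hge k). pose proof (Hmono (S k) (S x)). lia.
  - intros k x y H1 H2. apply Hh. now exists k.
Qed.

(** A hit inside one interval forces the constant to be 1, against the limit 0 along the infinite
    right part; having no hits above [m] contradicts the infinity of both parts. *)
Lemma p_homogeneous_not_avoided n f e Y Z :
  (forall x, limit_is f x false) ->
  (forall k x y, n k <= x -> y < n (S k) -> f x y = true) ->
  increasing_p_homogeneous f Z ->
  (forall v, eval Y e [v] (b2n (Z v))) ->
  ~ avoids n e Y.
Proof.
  intros Hlim Hf [HL [HR [c Hc]]] He.
  assert (HZ : forall v, eval Y e [v] 1 -> Z v = true).
  { intros v Hv. pose proof (eval_deterministic _ _ _ _ _ (He v) Hv) as H.
    now destruct (Z v). }
  intros [[k [a [b [H1 [H2 [H3 [Ha Hb]]]]]]]|[m Hm]].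
  - apply HZ in Ha, Hb.
    assert (c = true) as -> by now rewrite <- (Hc a b Ha Hb H2), (Hf k).
    destruct (Hlim a) as [N HN]. destruct (HR (N + S a)) as [y [Hy HRy]].
    assert (Hay : a < y) by lia.
    pose proof (Hc a y Ha HRy Hay) as H. rewrite HN in H by lia. discriminate.
  - destruct (HL m) as [a [Ha HLa]]. destruct (HR (S a)) as [b [Hb HRb]].
    apply (Hm (S b)). exists a, b. repeat split; try lia.
    + pose proof (He (2 * a)) as H. unfold left_part in HLa. now rewrite HLa in H.
    + pose proof (He (2 * b + 1)) as H. unfold right_part in HRb. now rewrite HRb in H.
Qed.

Theorem theorem1p7 : ~ SIPT22_sc_reducible_to_D22.
Proof.
  intros Hred.
  destruct generic_exists as [n Hn].
  destruct (interval_coloring n (proj1 Hn)) as [f [Hlim Hf]].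
  destruct (Hred f) as [g [Hg [_ Hsol]]]; [intros x; eauto|].
  (* As [g] is stable, any infinite subset of [A] or of its complement is limit homogeneous for
     [g]. *)
  destruct (characteristic_function nat (fun x => limit_is g x true)) as [A HA].
  destruct (one_sided_avoidance n A Hn) as [Y [i [Hinf [HYA Hav]]]].
  destruct (Hsol Y) as [Z [HZ [e He]]].
  - split; [easy|]. exists i. intros x Hx. apply HYA in Hx.
    destruct i; [now apply HA|].
    destruct (Hg x) as [[|] Hc]; [|easy]. apply HA in Hc. congruence.
  - exact (p_homogeneous_not_avoided n f e Y Z Hlim Hf HZ He (Hav e)).
Qed.
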